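(* The abelianization of the cactus Thompson group $CV$ is isomorphic to $\mathbb{Z}/2\mathbb{Z}\oplus\mathbb{Z}/2\mathbb{Z}$.
   Context: Trees. A rooted binary tree is a single vertex or a finite rooted tree in which every non-leaf vertex has a left child and a right child; its $n$ leaves are numbered $1,\dots,n$ from left to right. A caret is the rooted binary tree with two leaves. Attaching a caret to a leaf means identifying the root of the caret with that leaf. Cactus groups. $J_1=\{1\}$; for $n\ge2$, $J_n$ is generated by $s_{i,j}$ $(1\le i<j\le n)$ with relations $s_{i,j}^2=1$; $s_{i,j}s_{k,l}=s_{k,l}s_{i,j}$ for $i<j<k<l$; $s_{i,j}s_{k,l}=s_{i+j-l,i+j-k}s_{i,j}$ for $i\le k<l\le j$. The homomorphism $\pi_n:J_n\to S_n$ sends $s_{i,j}$ to the permutation $m\mapsto i+j-m$ for $i\le m\le j$, fixing all other $m$. Permutations are composed left to right: $(\sigma\tau)(m)=\tau(\sigma(m))$. The group $CV$. A cactus-tree pair is a triple $(T_+,s,T_-)$ with $T_\pm$ rooted binary trees with the same number $n$ of leaves and $s\in J_n$. For $1\le i\le n$, writing $s=s_{j_1,k_1}\cdots s_{j_l,k_l}$, put $p_1=i$ and let $p_{m+1}$ be the image of $p_m$ under $\pi_n(s_{j_m,k_m})$. Set $s'=s'_1\cdots s'_l\in J_{n+1}$, where $s'_m=s_{j_m,k_m}$ if $k_m<p_m$; $s'_m=s_{p_m,p_m+1}s_{j_m,k_m+1}$ if $j_m\le p_m\le k_m$; $s'_m=s_{j_m+1,k_m+1}$ if $p_m<j_m$.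 Attaching a caret to leaf $i$ of $T_+$ and to leaf $\pi_n(s)(i)$ of $T_-$ gives $T'_+,T'_-$; the triple $(T'_+,s',T'_-)$ is called an expansion of $(T_+,s,T_-)$. $CV$ is the set of cactus-tree pairs modulo the equivalence relation generated by expansions. Product: given two classes, choose representatives $(S_+,s,S_-)$, $(T_+,t,T_-)$ with $S_-=T_+$; the product is the class of $(S_+,st,T_-)$. The identity is the class of $(T,1,T)$ and the inverse of $(T_+,s,T_-)$ is $(T_-,s^{-1},T_+)$. *)

(* Defs.v *)
From HB Require Import structures.
From mathcomp Require Import all_boot all_order all_algebra all_fingroup.
From mathcomp Require Import generic_quotient.
From mathcomp Require Import boolp.
From mathcomp Require Import zify.
From Stdlib Require Import Relation_Operators.

Set Implicit Arguments.
Unset Strict Implicit.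
Unset Printing Implicit Defensive.

Local Open Scope nat_scope.
Local Open Scope quotient_scope.

(* Conventions. Leaves, positions and interval bounds are counted from 0: the
   generator s_{i,j}, 1 <= i < j <= n, is the pair (i-1, j-1). All the formulas
   used below (i + j - m, the shifts by 1, the comparisons) are unchanged by
   this translation. Permutations of 'S_n compose from left to right. *)

Definition cgen : Type := (nat * nat)%type.

Definition valid_gen (n : nat) (g : cgen) : bool := g.1 < g.2 < n.

Definition flip (g : cgen) (m : nat) : nat :=
  if g.1 <= m <= g.2 then g.1 + g.2 - m else m.

(* The generators are involutions, so the monoid with this presentation is
   the group with this presentation, and words need no inverse letters. *)
Inductive cactus_rel (n : nat) : seq cgen -> seq cgen -> Prop :=
| CactusInvol i j of i < j < n :
    cactus_rel n [:: (i, j); (i, j)] [::]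
| CactusComm i j k l of i < j & j < k & k < l < n :
    cactus_rel n [:: (i, j); (k, l)] [:: (k, l); (i, j)]
| CactusNest i j k l of i <= k & k < l & l <= j & j < n :
    cactus_rel n [:: (i, j); (k, l)] [:: (i + j - l, i + j - k); (i, j)].

Inductive cactus_eq (n : nat) : seq cgen -> seq cgen -> Prop :=
| CactusStep u v x y of cactus_rel n x y :
    cactus_eq n (u ++ x ++ v) (u ++ y ++ v)
| CactusRefl u : cactus_eq n u u
| CactusSym u v of cactus_eq n u v : cactus_eq n v u
| CactusTrans u v w of cactus_eq n u v & cactus_eq n v w : cactus_eq n u w.

Definition cword (n : nat) : Type := {w : seq cgen | all (valid_gen n) w}.
HB.instance Definition _ n := Choice.on (cword n).

Definition cword_eq (n : nat) : rel (cword n) :=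
  fun u v => `[< cactus_eq n (val u) (val v) >].

Lemma cword_eq_refl n : reflexive (@cword_eq n).
Proof. by move=> u; apply/asboolP; exact: CactusRefl. Qed.

Lemma cword_eq_sym n : symmetric (@cword_eq n).
Proof.
by move=> u v; apply/asboolP/asboolP => h; exact: CactusSym.
Qed.

Lemma cword_eq_trans n : transitive (@cword_eq n).
Proof.
by move=> v u w /asboolP h1 /asboolP h2; apply/asboolP; exact: CactusTrans h2.
Qed.

Canonical cword_equiv n :=
  EquivRel (@cword_eq n) (@cword_eq_refl n) (@cword_eq_sym n)
    (@cword_eq_trans n).

Definition cactus (n : nat) : Type := {eq_quot (@cword_eq n)}.
HB.instance Definition _ n := Choice.on (cactus n).
HB.instance Definition _ n := EqQuotient.on (cactus n).

Definition cactus_class n (w : seq cgen) (hw : all (valid_gen n) w) :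
  cactus n := \pi_(cactus n) (exist _ w hw).

Lemma cactusW n (P : cactus n -> Prop) :
  (forall w hw, P (@cactus_class n w hw)) -> forall s, P s.
Proof. by move=> h; apply: quotW => -[w hw]; exact: h. Qed.

Lemma cactus_classP n u v hu hv :
  @cactus_class n u hu = @cactus_class n v hv <-> cactus_eq n u v.
Proof.
split=> [/eqmodP/asboolP //|h]; apply/eqmodP; exact/asboolP.
Qed.

Lemma repr_classP n w hw :
  cactus_eq n (val (repr (@cactus_class n w hw))) w.
Proof.
suff /cactus_classP : cactus_class (valP (repr (@cactus_class n w hw))) =
  cactus_class hw by [].
rewrite -[RHS]reprK; congr (\pi_(cactus n) _); exact: val_inj.
Qed.

Lemma cactus_eq_catl n u v w : cactus_eq n v w -> cactus_eq n (u ++ v) (u ++ w).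
Proof.
elim=> [a b x y h|a|a b _|a b c _ h1 _ h2].
- by have := CactusStep (u ++ a) b h; rewrite -!catA.
- exact: CactusRefl.
- exact: CactusSym.
- exact: CactusTrans h1 h2.
Qed.

Lemma cactus_eq_catr n u v w : cactus_eq n v w -> cactus_eq n (v ++ u) (w ++ u).
Proof.
elim=> [a b x y h|a|a b _|a b c _ h1 _ h2].
- by have := CactusStep a (b ++ u) h; rewrite -!catA.
- exact: CactusRefl.
- exact: CactusSym.
- exact: CactusTrans h1 h2.
Qed.

Lemma cactus_eq_cat n u u' v v' :
  cactus_eq n u u' -> cactus_eq n v v' -> cactus_eq n (u ++ v) (u' ++ v').
Proof.
move=> hu hv; apply: CactusTrans (cactus_eq_catl _ hv).
exact: cactus_eq_catr.
Qed.

Lemma cactus_eq_rel n x y : cactus_rel n x y -> cactus_eq n x y.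
Proof. by move=> h; have := CactusStep [::] [::] h; rewrite /= !cats0. Qed.

Lemma cactus_rev_cat n w : all (valid_gen n) w -> cactus_eq n (rev w ++ w) [::].
Proof.
elim: w => [|[i j] w IH] /= => [_|/andP[hg hw]]; first exact: CactusRefl.
rewrite rev_cons -cats1 -catA /=.
apply: CactusTrans (IH hw).
have := CactusStep (rev w) w (CactusInvol hg); by [].
Qed.

Lemma cactus_cat_rev n w : all (valid_gen n) w -> cactus_eq n (w ++ rev w) [::].
Proof.
by move=> hw; have := @cactus_rev_cat n (rev w); rewrite revK all_rev; exact.
Qed.

Lemma valid_cat n u v : all (valid_gen n) u -> all (valid_gen n) v ->
  all (valid_gen n) (u ++ v).
Proof. by rewrite all_cat => -> ->. Qed.

Lemma valid_rev n u : all (valid_gen n) u -> all (valid_gen n) (rev u).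
Proof. by rewrite all_rev. Qed.

Definition cactus_one n : cactus n := @cactus_class n [::] isT.

Definition cactus_mul n (s t : cactus n) : cactus n :=
  cactus_class (valid_cat (valP (repr s)) (valP (repr t))).

Definition cactus_inv n (s : cactus n) : cactus n :=
  cactus_class (valid_rev (valP (repr s))).

Lemma cactus_mulE n u v hu hv huv :
  cactus_mul (@cactus_class n u hu) (@cactus_class n v hv) =
  @cactus_class n (u ++ v) huv.
Proof. by apply/cactus_classP/cactus_eq_cat; exact: repr_classP. Qed.

Lemma cactus_mulA n : associative (@cactus_mul n).
Proof.
elim/cactusW => u hu; elim/cactusW => v hv; elim/cactusW => w hw.
have huv := valid_cat hu hv; have hvw := valid_cat hv hw.
rewrite (cactus_mulE hu hv huv) (cactus_mulE hv hw hvw).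
rewrite (cactus_mulE _ _ (valid_cat hu hvw)).
rewrite (cactus_mulE _ _ (valid_cat huv hw)).
by apply/cactus_classP; rewrite catA; exact: CactusRefl.
Qed.

Lemma cactus_mul1 n : left_id (@cactus_one n) (@cactus_mul n).
Proof. by elim/cactusW => u hu; exact: (@cactus_mulE n [::] u isT hu hu). Qed.

Lemma cactus_mulr1 n : right_id (@cactus_one n) (@cactus_mul n).
Proof.
elim/cactusW => u hu; rewrite (@cactus_mulE n u [::] hu isT (@valid_cat n u [::] hu isT)).
by apply/cactus_classP; rewrite cats0; exact: CactusRefl.
Qed.

Lemma cactus_mulV n : left_inverse (@cactus_one n) (@cactus_inv n) (@cactus_mul n).
Proof.
move=> s; rewrite -{2}(reprK s) /cactus_inv.
case: (repr s) => w hw.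
rewrite (cactus_mulE _ hw (valid_cat (valid_rev hw) hw)).
by apply/cactus_classP; exact: cactus_rev_cat.
Qed.

Lemma cactus_mulrV n :
  right_inverse (@cactus_one n) (@cactus_inv n) (@cactus_mul n).
Proof.
move=> s; rewrite -{1}(reprK s) /cactus_inv.
case: (repr s) => w hw.
rewrite (cactus_mulE hw _ (valid_cat hw (valid_rev hw))).
by apply/cactus_classP; exact: cactus_cat_rev.
Qed.

HB.instance Definition _ n := isGroup.Build (cactus n)
  (@cactus_mulA n) (@cactus_mul1 n) (@cactus_mulr1 n)
  (@cactus_mulV n) (@cactus_mulrV n).

Lemma cactus_class_cat n u v hu hv huv :
  @cactus_class n (u ++ v) huv =
  (@cactus_class n u hu * @cactus_class n v hv)%g.
Proof. by rewrite -(cactus_mulE hu hv huv). Qed.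

Definition flip_ord n (g : cgen) (m : 'I_n) : 'I_n := insubd m (flip g m).

Lemma flip_ord_val n g (m : 'I_n) :
  (flip_ord g m : nat) = if flip g m < n then flip g m else m.
Proof. by rewrite val_insubd. Qed.

Lemma flip_ord_inj n g : injective (@flip_ord n g).
Proof.
have K : involutive (@flip_ord n g).
  move=> m; apply: val_inj; rewrite /= !flip_ord_val /flip.
  by have := ltn_ord m; do !case: ifP => //; lia.
exact: inv_inj.
Qed.

Definition gen_perm n (g : cgen) : 'S_n := perm (@flip_ord_inj n g).

Definition word_perm n (w : seq cgen) : 'S_n := (\prod_(g <- w) gen_perm n g)%g.

Definition cactus_perm n (s : cactus n) : 'S_n := word_perm n (val (repr s)).

Definition track (w : seq cgen) (p : nat) : nat := foldl (fun m g => flip g m) p w.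

Lemma flip_lt n g p : valid_gen n g -> p < n -> flip g p < n.
Proof. by case: g => j k; rewrite /valid_gen /flip /=; case: ifP; lia. Qed.

Lemma word_permE n w (i : 'I_n) : all (valid_gen n) w ->
  (word_perm n w i : nat) = track w i.
Proof.
rewrite /word_perm; elim: w i => [|g w IH] i /=.
  by rewrite big_nil perm1.
case/andP=> hg hw; rewrite big_cons permM IH // permE flip_ord_val.
by rewrite (flip_lt hg).
Qed.

Lemma track_cat u v p : track (u ++ v) p = track v (track u p).
Proof. exact: foldl_cat. Qed.

Lemma track_lt n w p : all (valid_gen n) w -> p < n -> track w p < n.
Proof.
elim: w p => [|g w IH] p //= /andP[hg hw] hp; apply: IH => //.
exact: flip_lt.
Qed.

Lemma track_eq n u v p : cactus_eq n u v -> track u p = track v p.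
Proof.
elim=> {u v} [u v x y h|//|//|u v w _ -> _ ->] //.
rewrite !track_cat; congr track; move: (track u p) => {p} p.
by case: h => [i j|i j k l|i j k l] *; rewrite /= /flip /=;
  do !case: ifP; lia.
Qed.

Lemma cactus_permE n w hw (i : 'I_n) :
  (cactus_perm (@cactus_class n w hw) i : nat) = track w i.
Proof.
rewrite word_permE; last exact: valP (repr (cactus_class hw)).
exact: track_eq (repr_classP hw).
Qed.

Lemma cactus_permM n (s t : cactus n) :
  cactus_perm (s * t)%g = (cactus_perm s * cactus_perm t)%g.
Proof.
elim/cactusW: s => u hu; elim/cactusW: t => v hv.
rewrite -(cactus_class_cat hu hv (valid_cat hu hv)).
apply/permP => i; apply: val_inj; rewrite permM /= !cactus_permE.
by rewrite track_cat.
Qed.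

Lemma cactus_perm1 n : cactus_perm (1 : cactus n)%g = 1%g.
Proof.
by apply/permP => i; apply: val_inj; rewrite [LHS]cactus_permE perm1.
Qed.

(* The word s' for the strand entering at position p: the recursive call
   moves from p_m to p_{m+1}. *)
Fixpoint clone_word (p : nat) (w : seq cgen) : seq cgen :=
  if w is (j, k) :: w' then
    (if k < p then [:: (j, k)]
     else if j <= p then [:: (p, p.+1); (j, k.+1)]
     else [:: (j.+1, k.+1)]) ++ clone_word (flip (j, k) p) w'
  else [::].

Lemma clone_cat p u v :
  clone_word p (u ++ v) = clone_word p u ++ clone_word (track u p) v.
Proof. by elim: u p => [|[j k] u IH] p //=; rewrite IH catA. Qed.

Lemma clone_valid n p w : p < n -> all (valid_gen n) w ->
  all (valid_gen n.+1) (clone_word p w).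
Proof.
elim: w p => [|[j k] w IH] p // hp /= /andP[hg hw].
rewrite all_cat IH ?andbT ?(flip_lt hg) //.
by move: hg; rewrite /valid_gen /=; do 2?case: ifP => ?; rewrite /= /valid_gen /=; lia.
Qed.

Definition skip (p q : nat) : nat := if p < q then q.+1 else q.

Local Ltac split_ifs :=
  repeat (match goal with |- context [if ?b then _ else _] =>
    lazymatch b with
    | context [if _ then _ else _] => fail
    | _ => let h := fresh "h" in case h: b
    end
  end; rewrite /=).

Local Ltac decide_ifs :=
  rewrite /flip /=;
  repeat (match goal with |- context [if ?b then _ else _] =>
    lazymatch b with
    | context [if _ then _ else _] => fail
    | _ => let h := fresh "h" in
      (have h : b = true by lia) + (have h : b = false by lia);
      rewrite h; clear h
    end
  end; rewrite /flip /=).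

Lemma track_clone w p q :
  track (clone_word p w) (skip p q) = skip (track w p) (track w q).
Proof.
elim: w p q => [|[j k] w IH] p q //.
rewrite [clone_word _ _]/= track_cat /= -IH; congr track.
rewrite /skip; have [?|?] := ltnP k p; last have [?|?] := leqP j p;
  by rewrite /= /flip /=; split_ifs; lia.
Qed.

Lemma cactus_eq_swap n a b c d v : a < b -> b < c -> c < d -> d < n ->
  cactus_eq n [:: (a, b), (c, d) & v] [:: (c, d), (a, b) & v].
Proof.
move=> h1 h2 h3 h4; have hr : cactus_rel n [:: (a, b); (c, d)] [:: (c, d); (a, b)].
  by apply: CactusComm => //; rewrite h3.
exact: (CactusStep [::] v hr).
Qed.

Lemma cactus_eq_nest n i j k l v : i <= k -> k < l -> l <= j -> j < n ->
  cactus_eq n [:: (i, j), (k, l) & v] [:: (i + j - l, i + j - k), (i, j) & v].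
Proof.
move=> h1 h2 h3 h4.
exact: (CactusStep [::] v (CactusNest h1 h2 h3 h4)).
Qed.

Lemma cactus_eq_nest' n i j k l k' l' v : i <= k -> k < l -> l <= j -> j < n ->
  k' = i + j - l -> l' = i + j - k ->
  cactus_eq n [:: (i, j), (k, l) & v] [:: (k', l'), (i, j) & v].
Proof. by move=> ? ? ? ? -> ->; exact: cactus_eq_nest. Qed.

Lemma cactus_eq_invol n i j v : i < j < n ->
  cactus_eq n [:: (i, j), (i, j) & v] v.
Proof. by move=> h; exact: (CactusStep [::] v (CactusInvol h)). Qed.

Lemma cactus_eq_cons n g u v : cactus_eq n u v -> cactus_eq n (g :: u) (g :: v).
Proof. exact: (@cactus_eq_catl n [:: g]). Qed.

Lemma clone_rel n x y p : cactus_rel n x y -> p < n ->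
  cactus_eq n.+1 (clone_word p x) (clone_word p y).
Proof.
move=> h hp; case: h => [i j hij|i j k l h1 h2 h3|i j k l h1 h2 h3 h4] /=.
- have [c|[c|[c1 c2]]] : j < p \/ p < i \/ i <= p /\ p <= j by lia.
  + by decide_ifs; apply: cactus_eq_invol; lia.
  + by decide_ifs; apply: cactus_eq_invol; lia.
  decide_ifs.
  apply: (@CactusTrans _ _ [:: (p, p.+1); (p, p.+1); (i, j.+1); (i, j.+1)]).
    by apply: cactus_eq_cons; apply: cactus_eq_nest'; lia.
  apply: CactusTrans (cactus_eq_invol _ _) _; first by lia.
  by apply: cactus_eq_invol; lia.
- have [c|[[c1 c2]|[[c1 c2]|[[c1 c2]|c]]]] : p < i \/ i <= p /\ p <= j \/
    j < p /\ p < k \/ k <= p /\ p <= l \/ l < p by lia.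
  + by decide_ifs; apply: cactus_eq_swap; lia.
  + decide_ifs.
    apply: (@CactusTrans _ _ [:: (p, p.+1); (k.+1, l.+1); (i, j.+1)]).
      by apply: cactus_eq_cons; apply: cactus_eq_swap; lia.
    by apply: cactus_eq_swap; lia.
  + by decide_ifs; apply: cactus_eq_swap; lia.
  + decide_ifs.
    apply: (@CactusTrans _ _ [:: (p, p.+1); (i, j); (k, l.+1)]).
      by apply: cactus_eq_swap; lia.
    by apply: cactus_eq_cons; apply: cactus_eq_swap; lia.
  + by decide_ifs; apply: cactus_eq_swap; lia.
- have [c|[c|[c1 c2]]] : j < p \/ p < i \/ i <= p /\ p <= j by lia.
  + by decide_ifs; apply: cactus_eq_nest'; lia.
  + by decide_ifs; apply: cactus_eq_nest'; lia.
  have [c|[c|[c3 c4]]] : p < i + j - l \/ i + j - k < p \/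
    i + j - l <= p /\ p <= i + j - k by lia.
  + decide_ifs.
    apply: (@CactusTrans _ _
        [:: (p, p.+1); ((i + j - l).+1, (i + j - k).+1); (i, j.+1)]).
      by apply: cactus_eq_cons; apply: cactus_eq_nest'; lia.
    by apply: cactus_eq_swap; lia.
  + decide_ifs.
    apply: (@CactusTrans _ _
        [:: (p, p.+1); (i + j - l, i + j - k); (i, j.+1)]).
      by apply: cactus_eq_cons; apply: cactus_eq_nest'; lia.
    by apply: CactusSym; apply: cactus_eq_swap; lia.
  decide_ifs.
  apply: (@CactusTrans _ _ [:: (i, j.+1); (k, l.+1)]).
    apply: (@CactusTrans _ _ [:: (p, p.+1); (p, p.+1); (i, j.+1); (k, l.+1)]).
      by apply: cactus_eq_cons; apply: cactus_eq_nest'; lia.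
    by apply: cactus_eq_invol; lia.
  apply: (@CactusTrans _ _ [:: (i + j - l, (i + j - k).+1); (i, j.+1)]).
    by apply: cactus_eq_nest'; lia.
  apply: CactusSym.
  apply: (@CactusTrans _ _
      [:: (p, p.+1); (p, p.+1); (i + j - l, (i + j - k).+1); (i, j.+1)]).
    by apply: cactus_eq_cons; apply: cactus_eq_nest'; lia.
  by apply: cactus_eq_invol; lia.
Qed.

Lemma valid_rel n x y : cactus_rel n x y ->
  all (valid_gen n) x /\ all (valid_gen n) y.
Proof.
by case=> *; rewrite /= /valid_gen /=; split; lia.
Qed.

Lemma cactus_eq_valid n u v : cactus_eq n u v ->
  all (valid_gen n) u = all (valid_gen n) v.
Proof.
elim=> {u v} [u v x y /valid_rel[hx hy]|//|//|u v w _ -> _ ->] //.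
by rewrite !all_cat hx hy.
Qed.

Lemma clone_eq n u v p : cactus_eq n u v -> all (valid_gen n) u -> p < n ->
  cactus_eq n.+1 (clone_word p u) (clone_word p v).
Proof.
move=> h; elim: h => {u v} [u v x y h|u|u v h IH|u v w h1 IH1 h2 IH2] hu hp.
- rewrite !clone_cat; apply: cactus_eq_catl.
  rewrite (track_eq _ (cactus_eq_rel h)); apply: cactus_eq_catr.
  apply: clone_rel => //; apply: track_lt hp.
  by move: hu; rewrite all_cat => /andP[].
- exact: CactusRefl.
- by apply: CactusSym; apply: IH => //; rewrite (cactus_eq_valid h).
- apply: CactusTrans (IH1 hu hp) (IH2 _ hp).
  by rewrite -(cactus_eq_valid h1).
Qed.

Lemma flip_inj g : injective (flip g).
Proof.
case: g => j k p q; rewrite /flip /=; do 2!case: ifP; lia.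
Qed.

Lemma clone_clone n w p q : p != q -> p < n -> q < n -> all (valid_gen n) w ->
  cactus_eq n.+2 (clone_word (skip p q) (clone_word p w))
                 (clone_word (skip q p) (clone_word q w)).
Proof.
elim: w p q => [|g w IH] p q hpq hp hq; first by move=> _; exact: CactusRefl.
case/andP=> hg hw.
have E a : clone_word a (g :: w) = clone_word a [:: g] ++ clone_word (flip g a) w.
  by case: (g) => j k /=; rewrite cats0.
rewrite !E !clone_cat !track_clone /=.
apply: cactus_eq_cat; last first.
  by apply: IH; rewrite ?(flip_lt hg) ?(inj_eq (@flip_inj g)).
wlog lpq : p q hpq hp hq {IH E w hw} / p < q => [W|].
  have [pq|qp|pq] := ltngtP p q; first exact: W.
    by apply: CactusSym; apply: W => //; rewrite eq_sym.
  by rewrite pq eqxx in hpq.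
case: g hg => j k /=; rewrite /valid_gen /= => hg.
have -> : skip p q = q.+1 by rewrite /skip lpq.
have -> : skip q p = p by rewrite /skip ltnNge (ltnW lpq).
rewrite !cats0.
have [c|[c|[c1 c2]]] : k < p \/ p < j \/ j <= p /\ p <= k by lia.
- by decide_ifs; exact: CactusRefl.
- have [d|[d|[d1 d2]]] : k < q \/ q < j \/ j <= q /\ q <= k by lia.
  + by decide_ifs; exact: CactusRefl.
  + by decide_ifs; exact: CactusRefl.
  + by decide_ifs; exact: CactusRefl.
have [d|d] : k < q \/ q <= k by lia.
  by decide_ifs; exact: CactusRefl.
by decide_ifs; apply: cactus_eq_swap; lia.
Qed.

Lemma cactus_clone_valid n (s : cactus n) (i : 'I_n) :
  all (valid_gen n.+1) (clone_word i (val (repr s))).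
Proof. exact: clone_valid (ltn_ord i) (valP (repr s)). Qed.

Definition cactus_clone n (s : cactus n) (i : 'I_n) : cactus n.+1 :=
  cactus_class (cactus_clone_valid s i).

Lemma cactus_cloneE n w hw (i : 'I_n) hw' :
  cactus_clone (@cactus_class n w hw) i =
  @cactus_class n.+1 (clone_word i w) hw'.
Proof.
apply/cactus_classP; apply: clone_eq (ltn_ord i); first exact: repr_classP.
exact: valP (repr _).
Qed.

Lemma cactus_clone1 n (i : 'I_n) : cactus_clone (1 : cactus n)%g i = 1%g.
Proof. exact: (@cactus_cloneE n [::] isT i isT). Qed.

Lemma cactus_cloneM n (s t : cactus n) (i : 'I_n) :
  cactus_clone (s * t)%g i =
  (cactus_clone s i * cactus_clone t (cactus_perm s i))%g.
Proof.
elim/cactusW: s => u hu; elim/cactusW: t => v hv.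
rewrite -(cactus_class_cat hu hv (valid_cat hu hv)).
have hu' := clone_valid (ltn_ord i) hu.
have hv' := clone_valid (ltn_ord (cactus_perm (cactus_class hu) i)) hv.
have huv' := clone_valid (ltn_ord i) (valid_cat hu hv).
rewrite (cactus_cloneE hu hu') (cactus_cloneE hv hv').
rewrite (cactus_cloneE _ huv') -(cactus_class_cat hu' hv' (valid_cat hu' hv')).
by apply/cactus_classP; rewrite clone_cat cactus_permE; exact: CactusRefl.
Qed.

Lemma skip_lt n p q : q < n -> skip p q < n.+1.
Proof. by rewrite /skip; case: ifP; lia. Qed.

Definition skip_ord n (i j : 'I_n) : 'I_n.+1 := Ordinal (skip_lt i (ltn_ord j)).

Lemma cactus_perm_clone n (s : cactus n) (i j : 'I_n) :
  cactus_perm (cactus_clone s i) (skip_ord i j) =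
  skip_ord (cactus_perm s i) (cactus_perm s j).
Proof.
elim/cactusW: s => u hu; apply: val_inj => /=.
by rewrite (cactus_cloneE hu (clone_valid (ltn_ord i) hu)) !cactus_permE
  track_clone.
Qed.

Lemma cactus_clone_clone n (s : cactus n) (i j : 'I_n) : i != j ->
  cactus_clone (cactus_clone s i) (skip_ord i j) =
  cactus_clone (cactus_clone s j) (skip_ord j i).
Proof.
move=> hij; elim/cactusW: s => u hu.
have hi := clone_valid (ltn_ord i) hu; have hj := clone_valid (ltn_ord j) hu.
rewrite (cactus_cloneE hu hi) (cactus_cloneE hu hj).
rewrite (cactus_cloneE hi (clone_valid (ltn_ord (skip_ord i j)) hi)).
rewrite (cactus_cloneE hj (clone_valid (ltn_ord (skip_ord j i)) hj)).
by apply/cactus_classP; apply: clone_clone.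
Qed.

Inductive bintree : Type :=
| Leaf
| Node of bintree & bintree.

Fixpoint leaves (t : bintree) : nat :=
  if t is Node l r then leaves l + leaves r else 1.

(* A leaf number out of range stands for the last leaf. *)
Fixpoint attach (t : bintree) (i : nat) : bintree :=
  match t with
  | Leaf => Node Leaf Leaf
  | Node l r =>
      if i < leaves l then Node (attach l i) r
      else Node l (attach r (i - leaves l))
  end.

Lemma leaves_attach t i : leaves (attach t i) = (leaves t).+1.
Proof.
by elim: t i => [|l IHl r IHr] i //=; case: ifP => _ /=;
  rewrite ?IHl ?IHr ?addSn ?addnS.
Qed.

Lemma leaves_gt0 t : 0 < leaves t.
Proof. by elim: t => [|l IHl r IHr] //=; rewrite addn_gt0 IHl. Qed.

Lemma attach_attach t p q : p != q -> p < leaves t -> q < leaves t ->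
  attach (attach t p) (skip p q) = attach (attach t q) (skip q p).
Proof.
elim: t p q => [|l IHl r IHr] p q hpq /= hp hq; first by lia.
have [pl|pl] : p < leaves l \/ leaves l <= p by lia.
  have [ql|ql] : q < leaves l \/ leaves l <= q by lia.
    rewrite pl ql /= !leaves_attach.
    have -> : skip p q < (leaves l).+1 by rewrite /skip; case: ifP; lia.
    have -> : skip q p < (leaves l).+1 by rewrite /skip; case: ifP; lia.
    by rewrite IHl.
  rewrite pl ltnNge ql /= !leaves_attach.
  have -> : skip p q = q.+1 by rewrite /skip; case: ifP; lia.
  have -> : skip q p = p by rewrite /skip; case: ifP; lia.
  by rewrite ltnS ltnNge ql pl subSS.
have [ql|ql] : q < leaves l \/ leaves l <= q by lia.
  rewrite ql ltnNge pl /= !leaves_attach.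
  have -> : skip p q = q by rewrite /skip; case: ifP; lia.
  have -> : skip q p = p.+1 by rewrite /skip; case: ifP; lia.
  by rewrite ltnS [p < _]ltnNge pl ql subSS.
rewrite ![_ < leaves l]ltnNge pl ql /=.
have -> : skip p q < leaves l = false by rewrite /skip; case: ifP; lia.
have -> : skip q p < leaves l = false by rewrite /skip; case: ifP; lia.
have -> : skip p q - leaves l = skip (p - leaves l) (q - leaves l).
  by rewrite /skip; do 2!case: ifP; lia.
have -> : skip q p - leaves l = skip (q - leaves l) (p - leaves l).
  by rewrite /skip; do 2!case: ifP; lia.
by rewrite IHr //; lia.
Qed.

(* v is obtained from t by attaching carets repeatedly (tle_attach, tle_grow) *)
Fixpoint tle (t v : bintree) : bool :=
  match t, v with
  | Leaf, _ => true
  | Node l r, Node l' r' => tle l l' && tle r r'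
  | Node _ _, Leaf => false
  end.

Lemma tle_refl t : tle t t.
Proof. by elim: t => //= l -> r ->. Qed.

Lemma tle_trans u t v : tle t u -> tle u v -> tle t v.
Proof.
elim: t u v => [|l IHl r IHr] [|l1 r1] [|l2 r2] //= /andP[h1 h2] /andP[h3 h4].
by rewrite (IHl _ _ h1 h3) (IHr _ _ h2 h4).
Qed.

Lemma tle_attach t i : tle t (attach t i).
Proof.
by elim: t i => [|l IHl r IHr] i //=; case: ifP => _ /=; rewrite ?IHl ?IHr ?tle_refl.
Qed.

Lemma tle_leaves t v : tle t v -> leaves t <= leaves v ?= iff (`[< t = v >]).
Proof.
elim: t v => [|l IHl r IHr] [|l' r'] //=.
- by move=> _; split; rewrite ?eqxx //; apply/esym/asboolP.
- move=> _; split; first by rewrite addn_gt0 leaves_gt0.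
  have -> : (1 == leaves l' + leaves r') = false.
    by have := leaves_gt0 l'; have := leaves_gt0 r'; lia.
  by apply/esym/asboolPn.
- case/andP=> /IHl [h1 e1] /IHr [h2 e2]; split; first exact: leq_add.
  apply/eqP/asboolP => [e|[-> ->] //].
  have /eqP : leaves l = leaves l' by lia.
  rewrite e1 => /asboolP ->.
  have /eqP : leaves r = leaves r' by lia.
  by rewrite e2 => /asboolP ->.
Qed.

Lemma tle_leq t v : tle t v -> leaves t <= leaves v.
Proof. by move/tle_leaves => -[]. Qed.

Lemma tle_eq t v : tle t v -> leaves t = leaves v -> t = v.
Proof. by move/tle_leaves => -[_ e] /eqP; rewrite e => /asboolP. Qed.

Lemma tle_grow t v : tle t v -> t <> v ->
  exists2 i, i < leaves t & tle (attach t i) v.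
Proof.
elim: t v => [|l IHl r IHr] [|l' r'] //= ; first by exists 0.
case/andP=> hl hr hne.
have [e|ne] := pselect (l = l'); last first.
  have [i hi h] := IHl _ hl ne.
  by exists i; [lia | rewrite hi /= h].
have ne : r <> r' by move=> e'; apply: hne; rewrite e e'.
have [i hi h] := IHr _ hr ne.
exists (leaves l + i); first by rewrite ltn_add2l.
have -> : leaves l + i < leaves l = false by lia.
by rewrite addKn /= hl.
Qed.

Lemma tle_attach2 t v p q : p != q -> p < leaves t -> q < leaves t ->
  tle (attach t p) v -> tle (attach t q) v ->
  tle (attach (attach t p) (skip p q)) v.
Proof.
elim: t v p q => [|l IHl r IHr] v p q hpq /= hp hq; first by lia.
have [pl|pl] : p < leaves l \/ leaves l <= p by lia.
  rewrite pl; case: v => [|l' r'] //= /andP[h1 h2].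
  have [ql|ql] : q < leaves l \/ leaves l <= q by lia.
    rewrite ql /= leaves_attach => /andP[h3 h4].
    have -> : skip p q < (leaves l).+1 by rewrite /skip; case: ifP; lia.
    by rewrite /= h2 andbT; exact: IHl.
  rewrite ltnNge ql /= leaves_attach => /andP[h3 h4].
  have -> : skip p q = q.+1 by rewrite /skip; case: ifP; lia.
  by rewrite ltnS ltnNge ql subSS /= h1.
rewrite ltnNge pl; case: v => [|l' r'] //= /andP[h1 h2].
have [ql|ql] : q < leaves l \/ leaves l <= q by lia.
  rewrite ql => /= /andP[h3 h4].
  have -> : skip p q = q by rewrite /skip; case: ifP; lia.
  by rewrite ql /= h3.
rewrite ltnNge ql /= => /andP[h3 h4].
have -> : skip p q < leaves l = false by rewrite /skip; case: ifP; lia.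
have -> : skip p q - leaves l = skip (p - leaves l) (q - leaves l).
  by rewrite /skip; do 2!case: ifP; lia.
by rewrite /= h1; apply: IHr => //; lia.
Qed.

Lemma tle_join t u : exists2 v, tle t v & tle u v.
Proof.
elim: t u => [|l IHl r IHr] u; first by exists u; rewrite ?tle_refl.
case: u => [|l' r']; first by exists (Node l r); rewrite ?tle_refl.
have [a h1 h2] := IHl l'; have [b h3 h4] := IHr r'.
by exists (Node a b); rewrite /= ?h1 ?h2.
Qed.

Definition btree (n : nat) : Type := {t : bintree | leaves t == n}.

Lemma battach_leaves n (t : btree n) (i : 'I_n) :
  leaves (attach (sval t) i) == n.+1.
Proof. by rewrite leaves_attach eqSS; exact: svalP t. Qed.

Definition battach n (t : btree n) (i : 'I_n) : btree n.+1 :=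
  exist _ (attach (sval t) i) (battach_leaves t i).

Lemma btree_inj n (t u : btree n) : sval t = sval u -> t = u.
Proof.
case: t u => [t ht] [u hu] /= e; case: _ / e hu => hu.
by congr exist; exact: bool_irrelevance.
Qed.

Lemma btree_leaves n (t : btree n) : leaves (sval t) = n.
Proof. exact/eqP/(svalP t). Qed.

Record ctpair : Type := CTPair {
  ct_size : nat;
  ct_plus : btree ct_size;
  ct_elt : cactus ct_size;
  ct_minus : btree ct_size }.

HB.instance Definition _ := gen_eqMixin ctpair.
HB.instance Definition _ := gen_choiceMixin ctpair.

Definition expand (P : ctpair) (i : 'I_(ct_size P)) : ctpair :=
  CTPair (battach (ct_plus P) i)
         (cactus_clone (ct_elt P) i)
         (battach (ct_minus P) (cactus_perm (ct_elt P) i)).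

Definition expansion (P Q : ctpair) : Prop := exists i, Q = @expand P i.

Definition ct_equiv : ctpair -> ctpair -> Prop :=
  clos_refl_sym_trans ctpair expansion.

Lemma CTPair_inj n (a a' b b' : btree n) (s s' : cactus n) :
  CTPair a s b = CTPair a' s' b' -> [/\ a = a', s = s' & b = b'].
Proof.
move=> e.
have h (P : ctpair) : P = CTPair a s b -> forall e' : ct_size P = n,
    [/\ a = eq_rect _ btree (ct_plus P) _ e',
        s = eq_rect _ cactus (ct_elt P) _ e' &
        b = eq_rect _ btree (ct_minus P) _ e'].
  by move=> -> /= e'; rewrite (eq_axiomK e').
by have [] := h _ (esym e) erefl.
Qed.

Lemma CTPair_eq n m (a b : btree n) s (a' b' : btree m) s' (e : n = m) :
  sval a = sval a' -> sval b = sval b' -> eq_rect n cactus s m e = s' ->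
  CTPair a s b = CTPair a' s' b'.
Proof.
by case: _ / e a' b' s' => a' b' s' /= /btree_inj -> /btree_inj -> ->.
Qed.

Local Notation expands := (clos_refl_trans_1n ctpair expansion).

Lemma expands_trans P Q R : expands P Q -> expands Q R -> expands P R.
Proof.
move=> h; elim: h R => {P Q} // P1 P2 P3 h _ IH R hR.
by apply: rt1n_trans h _; exact: IH.
Qed.

Lemma expands1 P Q : expansion P Q -> expands P Q.
Proof. by move=> h; exact: rt1n_trans h (rt1n_refl _ _ _). Qed.

Lemma expand_comm P (i j : 'I_(ct_size P)) : i != j ->
  @expand (expand i) (skip_ord i j) = @expand (expand j) (skip_ord j i).
Proof.
move=> hij; rewrite /expand /=; congr CTPair.
- apply: btree_inj => /=; apply: attach_attach => //; by rewrite btree_leaves.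
- exact: cactus_clone_clone.
- apply: btree_inj => /=; rewrite !cactus_perm_clone /=.
  apply: attach_attach; rewrite ?btree_leaves //.
  by rewrite (inj_eq val_inj) (inj_eq perm_inj).
Qed.

Lemma diamond P Q R : expansion P Q -> expansion P R ->
  Q = R \/ exists2 S, expansion Q S & expansion R S.
Proof.
move=> [i ->] [j ->]; have [->|hij] := eqVneq i j; first by left.
right; exists (@expand (expand i) (skip_ord i j)); first by eexists.
by exists (skip_ord j i); exact: expand_comm.
Qed.

Lemma confluent P Q R : expands P Q -> expands P R ->
  exists2 S, expands Q S & expands R S.
Proof.
have strip P' Q' R' : expansion P' Q' -> expands P' R' ->
    exists2 S, expands Q' S & expands R' S.
  move=> h1 h2; elim: h2 Q' h1 => {P' R'} [P'|P1 P2 P3 h12 h23 IH] Q' h1.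
    by exists Q'; [exact: rt1n_refl | exact: expands1].
  have [e|[S hQS hS]] := diamond h1 h12.
    by exists P3; [rewrite e | exact: rt1n_refl].
  have [T hT1 hT2] := IH _ hS.
  by exists T => //; exact: rt1n_trans hQS hT1.
move=> h; elim: h R => {P Q} [P|P1 P2 P3 h12 _ IH] R hR.
  by exists R => //; exact: rt1n_refl.
have [S h1 h2] := strip _ _ _ h12 hR.
have [T h3 h4] := IH _ h1.
by exists T => //; exact: expands_trans h2 h4.
Qed.

Lemma ct_equiv_common P Q : ct_equiv P Q ->
  exists2 R, expands P R & expands Q R.
Proof.
elim=> {P Q} [P Q h|P|P Q _ [R h1 h2]|P Q R _ [S h1 h2] _ [T h3 h4]].
- by exists Q; [exact: expands1 | exact: rt1n_refl].
- by exists P; exact: rt1n_refl.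
- by exists R.
- have [U h5 h6] := confluent h2 h3.
  by exists U; [exact: expands_trans h1 h5 | exact: expands_trans h4 h6].
Qed.

Lemma expands_equiv P Q : expands P Q -> ct_equiv P Q.
Proof.
elim=> {P Q} [P|P Q R h _ IH]; first exact: rst_refl.
by apply: rst_trans IH; exact: rst_step.
Qed.

Lemma expands_tle P Q : expands P Q ->
  tle (sval (ct_plus P)) (sval (ct_plus Q)).
Proof.
elim=> {P Q} [P|P Q R [i ->] _ IH]; first exact: tle_refl.
exact: tle_trans (tle_attach _ _) IH.
Qed.

Lemma expands_reach P Q (i : 'I_(ct_size P)) : expands P Q ->
  tle (attach (sval (ct_plus P)) i) (sval (ct_plus Q)) -> expands (expand i) Q.
Proof.
move=> h; elim: h i => {P Q} [P|P P1 Q [j ->] h IH] i hi.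
  by have := tle_leq hi; rewrite leaves_attach ltnn.
have [-> //|hij] := eqVneq i j.
apply: rt1n_trans (_ : expansion _ (@expand (expand i) (skip_ord i j))) _.
  by eexists.
rewrite expand_comm //; apply: IH => /=.
by apply: tle_attach2; rewrite ?btree_leaves // 1?eq_sym //; exact: expands_tle h.
Qed.

Lemma expands_inj P Q R : expands P Q -> expands P R ->
  sval (ct_plus Q) = sval (ct_plus R) -> Q = R.
Proof.
move=> h; elim: h R => {P Q} [P|P P1 Q [i ->] h IH] R hR e.
  case: hR e => {R} // P1 R [i ->] /expands_tle /tle_leq /= h e.
  by move: h; rewrite leaves_attach e ltnn.
by apply: IH => //; apply: expands_reach hR _; rewrite -e; exact: expands_tle h.
Qed.

Lemma expands_to P v : tle (sval (ct_plus P)) v ->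
  exists2 Q, expands P Q & sval (ct_plus Q) = v.
Proof.
have [k] := ubnP (leaves v - ct_size P); elim: k P => // k IH P hk hv.
have [e|ne] := pselect (sval (ct_plus P) = v).
  by exists P => //; exact: rt1n_refl.
have [i] := tle_grow hv ne; rewrite btree_leaves => hi h.
have [|Q h1 h2] := IH (expand (Ordinal hi)) _ h.
  by have := tle_leq h; rewrite leaves_attach btree_leaves /=; lia.
by exists Q => //; apply: rt1n_trans h1; eexists.
Qed.

Definition ct_inv (P : ctpair) : ctpair :=
  CTPair (ct_minus P) (ct_elt P)^-1%g (ct_plus P).

Lemma ct_invK : involutive ct_inv.
Proof. by case=> n a s b; rewrite /ct_inv /= invgK. Qed.

Lemma cactus_permV n (s : cactus n) : cactus_perm s^-1%g = (cactus_perm s)^-1%g.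
Proof.
by apply: (mulgI (cactus_perm s)); rewrite -cactus_permM !mulgV cactus_perm1.
Qed.

Lemma cactus_cloneV n (s : cactus n) (i : 'I_n) :
  cactus_clone s^-1%g (cactus_perm s i) = (cactus_clone s i)^-1%g.
Proof.
by apply: (mulgI (cactus_clone s i)); rewrite -cactus_cloneM !mulgV cactus_clone1.
Qed.

Lemma expansion_inv P Q : expansion P Q -> expansion (ct_inv P) (ct_inv Q).
Proof.
move=> [i ->]; exists (cactus_perm (ct_elt P) i).
by rewrite /expand /ct_inv /= cactus_cloneV cactus_permV permK.
Qed.

Lemma expands_inv P Q : expands P Q -> expands (ct_inv P) (ct_inv Q).
Proof.
elim=> {P Q} [P|P Q R h _ IH]; first exact: rt1n_refl.
by apply: rt1n_trans IH; exact: expansion_inv.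
Qed.

Lemma ct_equiv_inv P Q : ct_equiv P Q -> ct_equiv (ct_inv P) (ct_inv Q).
Proof.
elim=> {P Q} [P Q h|P|P Q _|P Q R _ h1 _ h2].
- by apply: rst_step; exact: expansion_inv.
- exact: rst_refl.
- exact: rst_sym.
- exact: rst_trans h1 h2.
Qed.

Inductive ct_mul : ctpair -> ctpair -> ctpair -> Prop :=
| CTMul n (S T U : btree n) (s t : cactus n) :
    ct_mul (CTPair S s T) (CTPair T t U) (CTPair S (s * t)%g U).

Lemma ct_mul_fun P Q R R' : ct_mul P Q R -> ct_mul P Q R' -> R = R'.
Proof.
case=> n S T U s t; move eP: (CTPair S s T) => P'; move eQ: (CTPair T t U) => Q' h.
case: h eP eQ => m S' T' U' s' t' eP.
have e : n = m := congr1 ct_size eP.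
case: _ / e S' T' U' s' t' eP => S' T' U' s' t' /CTPair_inj[-> -> _].
by move=> /CTPair_inj[_ -> ->].
Qed.

Lemma ct_mul_ex P Q : sval (ct_minus P) = sval (ct_plus Q) ->
  exists R, ct_mul P Q R.
Proof.
case: P Q => [n S s T] [m T' t U] /= e.
have enm : n = m by rewrite -(btree_leaves T) e btree_leaves.
case: _ / enm T' t U e => T' t U /btree_inj e.
by exists (CTPair S (s * t)%g U); rewrite e.
Qed.

Lemma ct_mul_minus P Q R : ct_mul P Q R ->
  sval (ct_minus P) = sval (ct_plus Q).
Proof. by case. Qed.

Lemma ct_mul_plus P Q R : ct_mul P Q R -> sval (ct_plus R) = sval (ct_plus P).
Proof. by case. Qed.

Lemma ct_mul_inv P Q R : ct_mul P Q R ->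
  ct_mul (ct_inv Q) (ct_inv P) (ct_inv R).
Proof. by case=> n S T U s t; rewrite /ct_inv /= invgM. Qed.

Lemma ct_mul_expand n (S T U : btree n) (s t : cactus n) (i : 'I_n) :
  ct_mul (@expand (CTPair S s T) i)
         (@expand (CTPair T t U) (cactus_perm s i))
         (@expand (CTPair S (s * t)%g U) i).
Proof. by rewrite /expand /= cactus_cloneM cactus_permM permM. Qed.

Lemma ct_mul_expansionl P Q R P' : ct_mul P Q R -> expansion P P' ->
  exists Q' R', [/\ expansion Q Q', expansion R R' & ct_mul P' Q' R'].
Proof.
case=> n S T U s t [i ->]; exists (@expand (CTPair T t U) (cactus_perm s i)).
exists (@expand (CTPair S (s * t)%g U) i); split; last exact: ct_mul_expand.
  by eexists.
by eexists.
Qed.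

Lemma ct_mul_expansion P Q R R' : ct_mul P Q R -> expansion R R' ->
  exists P' Q', [/\ expansion P P', expansion Q Q' & ct_mul P' Q' R'].
Proof.
case=> n S T U s t [i ->]; exists (@expand (CTPair S s T) i).
exists (@expand (CTPair T t U) (cactus_perm s i)); split; last exact: ct_mul_expand.
  by eexists.
by eexists.
Qed.

Lemma ct_mul_expandsl P Q R P' : ct_mul P Q R -> expands P P' ->
  exists Q' R', [/\ expands Q Q', expands R R' & ct_mul P' Q' R'].
Proof.
move=> h hP; elim: hP Q R h => {P P'} [P|P P1 P2 h1 _ IH] Q R h.
  by exists Q, R; split=> //; exact: rt1n_refl.
have [Q1 [R1 [hQ hR h']]] := ct_mul_expansionl h h1.
have [Q2 [R2 [hQ' hR' h'']]] := IH _ _ h'.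
by exists Q2, R2; split=> //; [exact: rt1n_trans hQ' | exact: rt1n_trans hR'].
Qed.

Lemma ct_mul_expands P Q R R' : ct_mul P Q R -> expands R R' ->
  exists P' Q', [/\ expands P P', expands Q Q' & ct_mul P' Q' R'].
Proof.
move=> h hR; elim: hR P Q h => {R R'} [R|R R1 R2 h1 _ IH] P Q h.
  by exists P, Q; split=> //; exact: rt1n_refl.
have [P1 [Q1 [hP hQ h']]] := ct_mul_expansion h h1.
have [P2 [Q2 [hP' hQ' h'']]] := IH _ _ h'.
by exists P2, Q2; split=> //; [exact: rt1n_trans hP' | exact: rt1n_trans hQ'].
Qed.

Lemma ct_mul_expandsr P Q R Q' : ct_mul P Q R -> expands Q Q' ->
  exists P' R', [/\ expands P P', expands R R' & ct_mul P' Q' R'].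
Proof.
move=> /ct_mul_inv h /expands_inv hQ.
have [P' [R' [h1 h2 h3]]] := ct_mul_expandsl h hQ.
exists (ct_inv P'), (ct_inv R'); split.
- by have := expands_inv h1; rewrite ct_invK.
- by have := expands_inv h2; rewrite ct_invK.
- by have := ct_mul_inv h3; rewrite ct_invK.
Qed.

Lemma ct_mul_equiv P Q R P' Q' R' : ct_mul P Q R -> ct_mul P' Q' R' ->
  ct_equiv P P' -> ct_equiv Q Q' -> ct_equiv R R'.
Proof.
move=> h h' /ct_equiv_common[P1 hP hP'] hQ.
have [Q1 [R1 [hQ1 hR1 h1]]] := ct_mul_expandsl h hP.
have [Q2 [R2 [hQ2 hR2 h2]]] := ct_mul_expandsl h' hP'.
have /ct_equiv_common[Q3 hQ13 hQ23] : ct_equiv Q1 Q2.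
  apply: rst_trans (expands_equiv hQ2).
  by apply: rst_trans hQ; apply: rst_sym; exact: expands_equiv.
have [P3 [R3 [hP3 hR3 h3]]] := ct_mul_expandsr h1 hQ13.
have [P4 [R4 [hP4 hR4 h4]]] := ct_mul_expandsr h2 hQ23.
have e : P3 = P4.
  apply: (can_inj ct_invK).
  apply: (expands_inj (expands_inv hP3) (expands_inv hP4)).
  by rewrite /= (ct_mul_minus h3) (ct_mul_minus h4).
rewrite -e in h4; have e' := ct_mul_fun h3 h4.
apply: (@rst_trans _ _ _ R3).
  by apply: expands_equiv; exact: expands_trans hR1 hR3.
by apply: rst_sym; apply: expands_equiv; rewrite e'; exact: expands_trans hR2 hR4.
Qed.

Lemma expands_minus P v : tle (sval (ct_minus P)) v ->
  exists2 Q, expands P Q & sval (ct_minus Q) = v.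
Proof.
move=> h; have [Q h1 h2] := @expands_to (ct_inv P) v h.
by exists (ct_inv Q) => //; have := expands_inv h1; rewrite ct_invK.
Qed.

Lemma ct_mul_total P Q : exists P' Q' R',
  [/\ expands P P', expands Q Q' & ct_mul P' Q' R'].
Proof.
have [v h1 h2] := tle_join (sval (ct_minus P)) (sval (ct_plus Q)).
have [P' hP eP] := expands_minus h1; have [Q' hQ eQ] := expands_to h2.
have [|R' h] := @ct_mul_ex P' Q'; first by rewrite eP eQ.
by exists P', Q', R'.
Qed.

Definition ct_eq : rel ctpair := fun P Q => `[< ct_equiv P Q >].

Lemma ct_eq_refl : reflexive ct_eq.
Proof. by move=> P; apply/asboolP; exact: rst_refl. Qed.

Lemma ct_eq_sym : symmetric ct_eq.
Proof. by move=> P Q; apply/asboolP/asboolP => h; exact: rst_sym. Qed.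

Lemma ct_eq_trans : transitive ct_eq.
Proof.
by move=> Q P R /asboolP h1 /asboolP h2; apply/asboolP; exact: rst_trans h2.
Qed.

Canonical ct_eq_equiv := EquivRel ct_eq ct_eq_refl ct_eq_sym ct_eq_trans.

Definition CV : Type := {eq_quot ct_eq}.
HB.instance Definition _ := Choice.on CV.
HB.instance Definition _ := EqQuotient.on CV.

Definition cv_class (P : ctpair) : CV := \pi_CV P.

Lemma cv_classP P Q : cv_class P = cv_class Q <-> ct_equiv P Q.
Proof. by split=> [/eqmodP/asboolP //|h]; apply/eqmodP; exact/asboolP. Qed.

Lemma cvW (A : CV -> Prop) : (forall P, A (cv_class P)) -> forall x, A x.
Proof. by move=> h; apply: quotW. Qed.

Definition cv_mul_rel (x y z : CV) : Prop :=
  exists P Q R, [/\ cv_class P = x, cv_class Q = y, cv_class R = z & ct_mul P Q R].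

Lemma cv_mul_fun x y z z' : cv_mul_rel x y z -> cv_mul_rel x y z' -> z = z'.
Proof.
move=> [P [Q [R [<- <- <- h]]]] [P' [Q' [R' [e1 e2 <- h']]]].
apply/cv_classP; apply: ct_mul_equiv h h' _ _; exact/cv_classP/esym.
Qed.

Lemma expands_class P Q : expands P Q -> cv_class Q = cv_class P.
Proof. by move=> h; apply/cv_classP/rst_sym; exact: expands_equiv. Qed.

Lemma cv_mul_ex x y : exists z, cv_mul_rel x y z.
Proof.
elim/cvW: x => P; elim/cvW: y => Q.
have [P' [Q' [R' [h1 h2 h3]]]] := ct_mul_total P Q.
by exists (cv_class R'), P', Q', R'; split=> //; exact: expands_class.
Qed.

Definition cv_mul (x y : CV) : CV := sval (cid (cv_mul_ex x y)).

Lemma cv_mulP x y z : cv_mul_rel x y z <-> cv_mul x y = z.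
Proof.
rewrite /cv_mul; case: cid => w hw /=; split=> [h|<- //].
exact: cv_mul_fun hw h.
Qed.

Lemma cv_mulE P Q R : ct_mul P Q R ->
  cv_mul (cv_class P) (cv_class Q) = cv_class R.
Proof. by move=> h; apply/cv_mulP; exists P, Q, R. Qed.

Definition ct_one n (T : btree n) : ctpair := CTPair T 1%g T.

Definition cv_one : CV := cv_class (@ct_one 1 (exist _ Leaf isT)).

Lemma expand_one n (T : btree n) i : @expand (ct_one T) i = ct_one (battach T i).
Proof. by rewrite /expand /ct_one /= cactus_clone1 cactus_perm1 perm1. Qed.

Lemma cv_oneE n (T : btree n) : cv_class (ct_one T) = cv_one.
Proof.
have [Q h e] := @expands_to (@ct_one 1 (exist _ Leaf isT)) (sval T) isT.
rewrite /cv_one -(expands_class h).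
have : exists m (U : btree m), Q = ct_one U.
  have : exists m (U : btree m), (@ct_one 1 (exist _ Leaf isT)) = ct_one U.
    by exists 1, (exist _ Leaf isT).
  elim: h => // P P1 P2 [i ->] _ IH [m [U e']]; apply: IH.
  move: i; rewrite e' => i; exists m.+1, (battach U i).
  exact: expand_one.
case=> m [U eQ]; rewrite eQ /= in e *.
have em : m = n by rewrite -(btree_leaves U) e btree_leaves.
by case: _ / em T e {h eQ} => T /btree_inj ->.
Qed.

Definition cv_inv (x : CV) : CV := cv_class (ct_inv (repr x)).

Lemma cv_invE P : cv_inv (cv_class P) = cv_class (ct_inv P).
Proof.
apply/cv_classP; apply: ct_equiv_inv; apply/cv_classP; exact: reprK.
Qed.

Lemma cv_mulA : associative cv_mul.
Proof.
elim/cvW => P; elim/cvW => Q; elim/cvW => S.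
have [P1 [Q1 [R1 [hP hQ h1]]]] := ct_mul_total P Q.
have [R2 [S2 [W [hR hS h2]]]] := ct_mul_total R1 S.
have [P3 [Q3 [hP3 hQ3 h3]]] := ct_mul_expands h1 hR.
rewrite -(expands_class hP) -(expands_class hQ) -(expands_class hS).
rewrite -(expands_class hP3) -(expands_class hQ3).
rewrite (cv_mulE h3) (cv_mulE h2).
have [X hX] : exists X, ct_mul Q3 S2 X.
  by apply: ct_mul_ex; rewrite -(ct_mul_minus h2); case: h3.
rewrite (cv_mulE hX).
have [Y hY] : exists Y, ct_mul P3 X Y.
  by apply: ct_mul_ex; rewrite (ct_mul_plus hX); exact: ct_mul_minus h3.
rewrite (cv_mulE hY); congr cv_class.
case: h3 hX hY h2 => n A B C s t hX.
move eQ: (CTPair B t C) hX => Q' hX; case: hX eQ => m B' C' D t' u eQ.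
have e : n = m := congr1 ct_size eQ.
case: _ / e B' C' D t' u eQ => B' C' D t' u /CTPair_inj[<- <- <-] hY h2.
rewrite (ct_mul_fun hY (CTMul A B D s (t * u)%g)).
by rewrite (ct_mul_fun h2 (CTMul A C D (s * t)%g u)) mulgA.
Qed.

Lemma cv_mul1 : left_id cv_one cv_mul.
Proof.
elim/cvW => -[n S s T]; rewrite -(cv_oneE S).
rewrite (cv_mulE (CTMul S S T 1%g s)).
by rewrite mul1g.
Qed.

Lemma cv_mulr1 : right_id cv_one cv_mul.
Proof.
elim/cvW => -[n S s T]; rewrite -(cv_oneE T).
rewrite (cv_mulE (CTMul S T T s 1%g)).
by rewrite mulg1.
Qed.

Lemma cv_mulV : left_inverse cv_one cv_inv cv_mul.
Proof.
elim/cvW => -[n S s T]; rewrite cv_invE.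
by rewrite (cv_mulE (CTMul T S T s^-1%g s)) mulVg; exact: cv_oneE.
Qed.

Lemma cv_mulrV : right_inverse cv_one cv_inv cv_mul.
Proof.
elim/cvW => -[n S s T]; rewrite cv_invE.
by rewrite (cv_mulE (CTMul S T S s s^-1%g)) mulgV; exact: cv_oneE.
Qed.

HB.instance Definition _ := isGroup.Build CV
  cv_mulA cv_mul1 cv_mulr1 cv_mulV cv_mulrV.

Inductive derived (G : groupType) : G -> Prop :=
| DerivedComm x y : derived [~ x, y]%g
| Derived1 : derived 1%g
| DerivedM x y of derived x & derived y : derived (x * y)%g
| DerivedV x of derived x : derived x^-1%g.

Lemma derivedJ (G : groupType) (x y : G) : derived x -> derived (x ^ y)%g.
Proof.
move=> h; rewrite -[(x ^ y)%g](mulKVg x).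
have -> : (x^-1 * x ^ y = [~ x, y])%g by [].
by apply: DerivedM => //; exact: DerivedComm.
Qed.

Definition der_eq (G : groupType) : rel G :=
  fun x y => `[< derived (x^-1 * y)%g >].

Lemma der_eq_refl (G : groupType) : reflexive (@der_eq G).
Proof. by move=> x; apply/asboolP; rewrite mulVg; exact: Derived1. Qed.

Lemma der_eq_sym (G : groupType) : symmetric (@der_eq G).
Proof.
by move=> x y; apply/asboolP/asboolP => /DerivedV; rewrite invgM invgK.
Qed.

Lemma der_eq_trans (G : groupType) : transitive (@der_eq G).
Proof.
move=> y x z /asboolP h1 /asboolP h2; apply/asboolP.
by rewrite -(mulKVg y z) mulgA; exact: DerivedM.
Qed.

Canonical der_eq_equiv (G : groupType) :=
  EquivRel (@der_eq G) (@der_eq_refl G) (@der_eq_sym G) (@der_eq_trans G).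

Definition abelianization (G : groupType) : Type := {eq_quot (@der_eq G)}.
HB.instance Definition _ (G : groupType) := Choice.on (abelianization G).
HB.instance Definition _ (G : groupType) := EqQuotient.on (abelianization G).

Section AbelianizationGroup.
Variable G : groupType.

Definition ab_class (x : G) : abelianization G := \pi_(abelianization G) x.

Lemma ab_classP x y : ab_class x = ab_class y <-> derived (x^-1 * y)%g.
Proof. by split=> [/eqmodP/asboolP //|h]; apply/eqmodP; exact/asboolP. Qed.

Lemma abW (A : abelianization G -> Prop) :
  (forall x, A (ab_class x)) -> forall x, A x.
Proof. by move=> h; apply: quotW. Qed.

Definition ab_one : abelianization G := ab_class 1%g.

Definition ab_mul (x y : abelianization G) : abelianization G :=
  ab_class (repr x * repr y)%g.

Definition ab_inv (x : abelianization G) : abelianization G :=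
  ab_class (repr x)^-1%g.

Lemma repr_ab x : derived ((repr (ab_class x))^-1 * x)%g.
Proof. by apply/ab_classP; exact: reprK. Qed.

Lemma ab_mulE x y : ab_mul (ab_class x) (ab_class y) = ab_class (x * y)%g.
Proof.
apply/ab_classP; have hx := repr_ab x; have hy := repr_ab y.
set x' := repr (ab_class x) in hx *; set y' := repr (ab_class y) in hy *.
have -> : ((x' * y')^-1 * (x * y) = (x'^-1 * x) ^ y' * (y'^-1 * y))%g.
  by rewrite conjgE invgM !mulgA mulgK.
by apply: DerivedM => //; exact: derivedJ.
Qed.

Lemma ab_invE x : ab_inv (ab_class x) = ab_class x^-1%g.
Proof.
apply/ab_classP; have := repr_ab x; move: (repr _) => x' h.
have -> : (x'^-1^-1 * x^-1 = ((x'^-1 * x)^-1) ^ (x'^-1))%g.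
  by rewrite conjgE invgM !invgK !mulgA mulgK.
by apply: derivedJ; exact: DerivedV.
Qed.

Lemma ab_mulA : associative ab_mul.
Proof.
by elim/abW => x; elim/abW => y; elim/abW => z; rewrite !ab_mulE mulgA.
Qed.

Lemma ab_mul1 : left_id ab_one ab_mul.
Proof. by elim/abW => x; rewrite ab_mulE mul1g. Qed.

Lemma ab_mulr1 : right_id ab_one ab_mul.
Proof. by elim/abW => x; rewrite ab_mulE mulg1. Qed.

Lemma ab_mulV : left_inverse ab_one ab_inv ab_mul.
Proof. by elim/abW => x; rewrite ab_invE ab_mulE mulVg. Qed.

Lemma ab_mulrV : right_inverse ab_one ab_inv ab_mul.
Proof. by elim/abW => x; rewrite ab_invE ab_mulE mulgV. Qed.

End AbelianizationGroup.

HB.instance Definition _ (G : groupType) := isGroup.Build (abelianization G)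
  (@ab_mulA G) (@ab_mul1 G) (@ab_mulr1 G) (@ab_mulV G) (@ab_mulrV G).

(* Main.v *)
Require Import Defs.
From mathcomp Require Import all_boot all_order all_algebra.
From mathcomp Require Import all_fingroup generic_quotient boolp zify.

Set Implicit Arguments.
Unset Strict Implicit.
Unset Printing Implicit Defensive.

Local Open Scope nat_scope.

(** Write [S, s, T] for the image of a cactus-tree pair in the abelianization A
of CV. The proof bounds A from above by two involutions, and from below by two
parities.

Upper bound. Since [S, s, T] [T, t, U] = [S, st, U] and A is commutative, the
loop [T, s, T] depends only on s, so every pair is a product of loops at single
generators times an element [S, 1, T] coming from Thompson's group F.
- Inside J_n, a generator that does not flip all strands is conjugate to every
  other one of the same length, and cloning a strand outside its interval does
  not change it; hence its loop is an element x_L of A depending only on its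
  length L (loop_ab_span).
- Cloning the strand p inside the interval of s_{j,k} gives, with
  T_p the tree T with a caret at p and q = j + k - p,
  [T, s_{j,k}, T] = x_2 [T_p, s_{j,k+1}, T_p] [T_p, 1, T_q] (loop_ab_inside).
  For an interval of length 2 this reads [T_p, 1, T_{p+1}] = x_3^-1, whatever
  p and whatever T with at least three leaves. Comparing a move by one leaf with
  a move by two leaves in a larger tree turns this into x_3^-1 = x_3^-2
  (pair_ab_caret01), so x_3 = 1 and then all of F dies in A (pair_ab_one).
- What remains is x_L = x_2 x_{L+1}, and y_n = x_2 y_{n+1} for the loops y_n at
  the generators flipping all n strands. As x_2 and y_2 are involutions, A is
  generated by them, with x_L = x_2^(L-1) and y_n = y_2 x_2^n (loop_ab_gen,
  loop_ab_full).

Lower bound. For a pair with word w on n strands, the parity of the number of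
letters flipping all n strands and the parity of the number of letters of even
length are unchanged by the cactus relations and by cloning: a letter whose
interval contains the cloned strand becomes one letter of length 2 and one that
is longer by 1 (weight_clone). They define a morphism to Z/2 x Z/2 taking x_2 to
(0, 1) and y_2 to (1, 1). By the upper bound the class in A of an element is
determined by its image. *)

(** * Cactus words *)

(** Extended by 1 to invalid words, so that words can be manipulated without
carrying validity proofs inside the terms. *)
Definition word_elt n (w : seq cgen) : cactus n :=
  match @idP (all (valid_gen n) w) with
  | ReflectT hw => cactus_class hw
  | ReflectF _ => 1%g
  end.

Lemma word_eltE n w (hw : all (valid_gen n) w) : word_elt n w = cactus_class hw.
Proof.
rewrite /word_elt; case: {-}_ / idP => [h|/(_ hw) //].
by congr cactus_class; exact: bool_irrelevance.
Qed.

Lemma word_eltP n (P : cactus n -> Prop) :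
  (forall w, all (valid_gen n) w -> P (word_elt n w)) -> forall s, P s.
Proof. by move=> h; elim/cactusW => w hw; rewrite -word_eltE; exact: h. Qed.

Lemma word_elt_cat n u v : all (valid_gen n) u -> all (valid_gen n) v ->
  word_elt n (u ++ v) = (word_elt n u * word_elt n v)%g.
Proof.
move=> hu hv; rewrite (word_eltE (valid_cat hu hv)) (cactus_class_cat hu hv).
by rewrite -!word_eltE.
Qed.

Lemma word_elt_eq n u v : all (valid_gen n) u -> cactus_eq n u v ->
  word_elt n u = word_elt n v.
Proof.
move=> hu huv; have hv : all (valid_gen n) v by rewrite -(cactus_eq_valid huv).
by rewrite (word_eltE hu) (word_eltE hv); apply/cactus_classP.
Qed.

Lemma word_elt_clone n w (i : 'I_n) : all (valid_gen n) w ->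
  cactus_clone (word_elt n w) i = word_elt n.+1 (clone_word i w).
Proof.
move=> hw; have hw' := clone_valid (ltn_ord i) hw.
by rewrite (word_eltE hw) (word_eltE hw'); exact: cactus_cloneE.
Qed.

Lemma word_elt_perm n w (i : 'I_n) : all (valid_gen n) w ->
  cactus_perm (word_elt n w) i = track w i :> nat.
Proof. by move=> hw; rewrite (word_eltE hw) cactus_permE. Qed.

(** * Trees *)

Lemma attach_surj t : 1 < leaves t ->
  exists t' i, i < leaves t' /\ t = attach t' i.
Proof.
elim: t => [|l IHl r IHr] //= _.
have [/IHl[l' [i [hi ->]]]|hl] := ltnP 1 (leaves l).
  by exists (Node l' r), i; rewrite /= hi; split=> //; lia.
have [/IHr[r' [i [hi ->]]]|hr] := ltnP 1 (leaves r).
  exists (Node l r'), (leaves l + i); rewrite /= addKn; split; first by lia.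
  by rewrite ltnNge leq_addr.
exists Leaf, 0; split=> //.
case: l hl {IHl} => [|a b] /=.
  case: r hr {IHr} => [|a b] //=.
  by have := leaves_gt0 a; have := leaves_gt0 b; lia.
by have := leaves_gt0 a; have := leaves_gt0 b; lia.
Qed.

Lemma battach_surj n (T : btree n.+2) :
  exists (T' : btree n.+1) (i : 'I_n.+1), T = battach T' i.
Proof.
have hT := btree_leaves T.
have [|t' [i [hi e]]] := @attach_surj (sval T); first by rewrite hT.
have ht' : leaves t' == n.+1 by move: hT; rewrite e leaves_attach => -[->].
have hi' : i < n.+1 by rewrite -(eqP ht').
exists (exist _ t' ht'), (Ordinal hi'); exact: btree_inj.
Qed.

Fixpoint comb n : bintree := if n is m.+1 then attach (comb m) 0 else Leaf.

Lemma leaves_comb n : leaves (comb n) == n.+1.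
Proof. by elim: n => //= n /eqP h; rewrite leaves_attach h. Qed.

(** Some tree with n + 1 leaves; by pair_ab_loop below, which one is chosen does
not affect the values of loop_ab. *)
Definition bcomb n : btree n.+1 := exist _ (comb n) (leaves_comb n).

(** * Classes of cactus-tree pairs in the abelianization *)

Local Notation CVab := (abelianization CV).

Lemma ab_classM (G : groupType) (x y : G) :
  ab_class (x * y)%g = (ab_class x * ab_class y)%g.
Proof. by rewrite -ab_mulE. Qed.

Lemma ab_mulC (G : groupType) (a b : abelianization G) : (a * b = b * a)%g.
Proof.
elim/abW: a => x; elim/abW: b => y; rewrite -!ab_classM; apply/ab_classP.
by rewrite invgM -mulgA; exact: DerivedComm.
Qed.

Definition pair_ab n (S : btree n) (s : cactus n) (T : btree n) : CVab :=
  ab_class (cv_class (CTPair S s T)).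

Lemma pair_abM n (S T U : btree n) s t :
  (pair_ab S s T * pair_ab T t U = pair_ab S (s * t) U)%g.
Proof.
rewrite /pair_ab -ab_classM; congr ab_class.
exact: cv_mulE (CTMul S T U s t).
Qed.

Lemma pair_ab1 n (T : btree n) : pair_ab T 1%g T = 1%g.
Proof. by rewrite /pair_ab [cv_class _](cv_oneE T). Qed.

Lemma pair_ab_expand n (S T : btree n) s (i : 'I_n) :
  pair_ab (battach S i) (cactus_clone s i) (battach T (cactus_perm s i)) =
  pair_ab S s T.
Proof.
rewrite /pair_ab; congr ab_class; apply: (@expands_class (CTPair S s T)).
by apply: expands1; exists i.
Qed.

Lemma pair_ab_expand1 n (S T : btree n) (i : 'I_n) :
  pair_ab (battach S i) 1%g (battach T i) = pair_ab S 1%g T.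
Proof.
by rewrite -(pair_ab_expand S T 1%g i) cactus_clone1 cactus_perm1 perm1.
Qed.

(** The two loops are conjugate by the class of (S, 1, T). *)
Lemma pair_ab_loop n (S T : btree n) s : pair_ab S s S = pair_ab T s T.
Proof.
have e := pair_abM S T S 1%g 1%g.
rewrite mulg1 pair_ab1 in e.
rewrite -[s in LHS]mul1g -(pair_abM S T S) -[s in LHS]mulg1 -(pair_abM T T S).
by rewrite mulgA [(pair_ab S _ _ * _)%g]ab_mulC -mulgA e mulg1.
Qed.

(** The index is the number of strands minus 1, since trees have at least one
leaf; the generator flipping all strands is then (0, n). *)
Definition loop_ab n (w : seq cgen) : CVab :=
  pair_ab (bcomb n) (word_elt n.+1 w) (bcomb n).

Lemma loop_abE n (T : btree n.+1) w :
  pair_ab T (word_elt n.+1 w) T = loop_ab n w.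
Proof. exact: pair_ab_loop. Qed.

Lemma loop_ab_cat n u v : all (valid_gen n.+1) u -> all (valid_gen n.+1) v ->
  loop_ab n (u ++ v) = (loop_ab n u * loop_ab n v)%g.
Proof. by move=> hu hv; rewrite /loop_ab word_elt_cat // pair_abM. Qed.

Lemma loop_ab_eq n u v : all (valid_gen n.+1) u -> cactus_eq n.+1 u v ->
  loop_ab n u = loop_ab n v.
Proof. by move=> hu huv; rewrite /loop_ab (word_elt_eq hu huv). Qed.

Lemma loop_ab_nil n : loop_ab n [::] = 1%g.
Proof. by rewrite /loop_ab (word_eltE (isT : all _ [::])); exact: pair_ab1. Qed.

Lemma loop_ab_cons n g w : valid_gen n.+1 g -> all (valid_gen n.+1) w ->
  loop_ab n (g :: w) = (loop_ab n [:: g] * loop_ab n w)%g.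
Proof. by move=> hg hw; rewrite -loop_ab_cat //= hg. Qed.

(** * Loops at generators *)

Lemma loop_ab_sqr n g : valid_gen n.+1 g ->
  (loop_ab n [:: g] * loop_ab n [:: g] = 1)%g.
Proof.
case: g => i j hg; rewrite -loop_ab_cat /= ?hg // -(loop_ab_nil n).
by apply: loop_ab_eq; [rewrite /= hg | apply/cactus_eq_rel/CactusInvol].
Qed.

(** Both intervals lie in [i, j+1], and the flip of that interval exchanges
them, so the two generators are conjugate. *)
Lemma loop_ab_shift n i j : i < j < n ->
  loop_ab n [:: (i, j)] = loop_ab n [:: (i.+1, j.+1)].
Proof.
move=> hij; apply: (@mulgI _ (loop_ab n [:: (i, j.+1)])).
rewrite [RHS]ab_mulC -!loop_ab_cat /= /valid_gen /= ?andbT; try lia.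
apply: loop_ab_eq; first by rewrite /= /valid_gen /=; lia.
by apply: cactus_eq_nest'; lia.
Qed.

Lemma loop_ab_slide n i d : 0 < d -> d < n -> i + d <= n ->
  loop_ab n [:: (i, i + d)] = loop_ab n [:: (0, d)].
Proof.
move=> hd hn; elim: i => [|i IH] // h.
by rewrite addSn -loop_ab_shift; [apply: IH; lia | lia].
Qed.

(** Cloning the last strand, which the generator does not move, attaches a caret
to the same leaf of both trees. *)
Lemma loop_ab_outside n i j : i < j < n ->
  loop_ab n [:: (i, j)] = loop_ab n.+1 [:: (i, j)].
Proof.
move=> hij; have hv : all (valid_gen n.+1) [:: (i, j)].
  by rewrite /= /valid_gen /=; lia.
rewrite -(loop_abE (battach (bcomb n) ord_max)) /loop_ab.
rewrite -(pair_ab_expand _ _ _ ord_max) (word_elt_clone _ hv).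
have -> : cactus_perm (word_elt n.+1 [:: (i, j)]) ord_max = ord_max.
  apply: val_inj; rewrite /= word_elt_perm //= /flip /=.
  by case: ifP => //; lia.
rewrite /=; have -> : j < n = true by lia.
by [].
Qed.

(** The bound d < n is what excludes the generator flipping all strands, whose
class does depend on n. *)
Lemma loop_ab_span n i d : 0 < d -> d < n -> i + d <= n ->
  loop_ab n [:: (i, i + d)] = loop_ab d.+1 [:: (0, d)].
Proof.
move=> hd hn hi; rewrite loop_ab_slide //.
elim: n hn {i hi} => // n IH hn.
have [e|ne] := eqVneq d n; first by rewrite e.
by rewrite -loop_ab_outside; [apply: IH; lia | lia].
Qed.

(** Cloning the strand p, which the generator sends to q, puts carets on
different leaves of the two trees, so a factor from Thompson's group F
appears. *)
Lemma loop_ab_inside n (T : btree n.+1) (j k : nat) (p q : 'I_n.+1) :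
  j < k <= n -> j <= p <= k -> p + q = j + k ->
  loop_ab n [:: (j, k)] =
    (loop_ab n.+1 [:: (p : nat, p.+1)] * loop_ab n.+1 [:: (j, k.+1)] *
     pair_ab (battach T p) 1 (battach T q))%g.
Proof.
move=> hjk hp hpq.
have hv : all (valid_gen n.+1) [:: (j, k)] by rewrite /= /valid_gen /=; lia.
rewrite -(loop_abE T) -(pair_ab_expand _ _ _ p) (word_elt_clone _ hv).
have -> : cactus_perm (word_elt n.+1 [:: (j, k)]) p = q.
  apply: val_inj; rewrite /= word_elt_perm //= /flip /=.
  by case: ifP => //; lia.
rewrite /=; have -> : (k < p) = false by lia.
have -> : (j <= p) = true by lia.
rewrite -[word_elt _ _]mulg1 -(pair_abM _ (battach T p)) loop_abE.
by rewrite loop_ab_cons //; rewrite /= /valid_gen /=; lia.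
Qed.

(** * Thompson's group F dies in the abelianization *)

(** This is loop_ab_inside for the interval [p, p+1]: the letters of length 2 on
the two sides cancel and a letter of length 3 remains. *)
Lemma pair_ab_succ n (T : btree n.+1) (p q : 'I_n.+1) :
  1 < n -> q = p.+1 :> nat ->
  pair_ab (battach T p) 1%g (battach T q) = (loop_ab 3 [:: (0, 2)])^-1%g.
Proof.
move=> hn e; have hq := ltn_ord q.
have := @loop_ab_inside n T p q p q.
rewrite e -addn2 -addn1 !loop_ab_span; try lia.
move=> /(_ _ _ erefl) h; apply/esym/mulg1_eq.
apply: (@mulgI _ (loop_ab 2 [:: (0, 1)])); rewrite mulg1 mulgA [RHS]h //; lia.
Qed.

(** A caret added at leaf 0 on both sides changes nothing, but turns the move of
a caret from leaf 0 to leaf 1 into a move by two leaves, that is, two moves by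
one leaf in a tree large enough for pair_ab_succ. *)
Lemma pair_ab_caret01 n (T : btree n.+2) :
  pair_ab (battach T ord0) 1%g (battach T (inord 1)) =
  ((loop_ab 3 [:: (0, 2)])^-1 * (loop_ab 3 [:: (0, 2)])^-1)%g.
Proof.
have e1 : (inord 1 : 'I_n.+2) = 1 :> nat by rewrite inordK.
have f1 : (inord 1 : 'I_n.+3) = 1 :> nat by rewrite inordK.
have f2 : (inord 2 : 'I_n.+3) = 2 :> nat by rewrite inordK.
rewrite -(pair_ab_expand1 _ _ ord0).
have -> : battach (battach T (inord 1)) ord0 =
    battach (battach T ord0) (inord 2).
  apply: btree_inj; rewrite /= e1 f2.
  by apply: (@attach_attach (sval T) 1 0); rewrite ?btree_leaves.
rewrite -[1%g in LHS]mulg1 -(pair_abM _ (battach (battach T ord0) (inord 1))).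
by congr (_ * _)%g; apply: pair_ab_succ; rewrite ?f1 ?f2.
Qed.

(** In a tree with at least three leaves a move from leaf 0 to leaf 1 is
evaluated both by pair_ab_succ and by pair_ab_caret01, which gives c = c^2. *)
Lemma loop_ab_span3 : loop_ab 3 [:: (0, 2)] = 1%g.
Proof.
have := pair_ab_caret01 (bcomb 2); rewrite pair_ab_succ ?inordK // => h.
apply: invg_inj; rewrite invg1; apply: (mulgI (loop_ab 3 [:: (0, 2)])^-1%g).
by rewrite -h mulg1.
Qed.

(** Moves by one leaf compose to all moves. *)
Lemma pair_ab_attach n (T : btree n.+1) (p q : 'I_n.+1) :
  pair_ab (battach T p) 1%g (battach T q) = 1%g.
Proof.
suff h (r : 'I_n.+1) : pair_ab (battach T ord0) 1%g (battach T r) = 1%g.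
  have := pair_abM (battach T ord0) (battach T p) (battach T q) 1%g 1%g.
  by rewrite mulg1 !h mul1g.
case: r => r; elim: r => [|r IH] hr.
  by have -> : Ordinal hr = ord0 by [exact: val_inj]; exact: pair_ab1.
have hr' : r < n.+1 by lia.
rewrite -[1%g in LHS]mulg1 -(pair_abM _ (battach T (Ordinal hr'))) IH mul1g.
(* pair_ab_succ needs three leaves; over a caret only the move from leaf 0 to
   leaf 1 is left, covered by pair_ab_caret01. *)
have [n1|n1] := ltnP 1 n; first by rewrite pair_ab_succ // loop_ab_span3 invg1.
have en : n = 1 by lia.
move: T hr hr' {IH}; rewrite en => T hr hr'.
have -> : Ordinal hr' = ord0 by apply: val_inj => /=; lia.
have -> : Ordinal hr = inord 1 by apply: val_inj; rewrite /= inordK; lia.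
by rewrite pair_ab_caret01 loop_ab_span3 invg1 mulg1.
Qed.

(** Both trees arise by adding one caret to smaller trees; moving one of the
carets to the place of the other reduces to the smaller trees. *)
Lemma pair_ab_one n (S T : btree n.+1) : pair_ab S 1%g T = 1%g.
Proof.
elim: n S T => [|n IH] S T.
  suff -> : S = T by exact: pair_ab1.
  have leaf1 (U : btree 1) : sval U = Leaf.
    case: U => -[|a b] //= h; have := leaves_gt0 a; have := leaves_gt0 b; lia.
  by apply: btree_inj; rewrite !leaf1.
have [S' [p ->]] := battach_surj S; have [T' [q ->]] := battach_surj T.
rewrite -[1%g in LHS]mulg1 -(pair_abM _ (battach T' p)) pair_ab_attach mulg1.
by rewrite pair_ab_expand1.
Qed.

(** * Generation by two involutions *)

Lemma loop_ab_rec n j k : j < k <= n ->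
  loop_ab n [:: (j, k)] =
    (loop_ab n.+1 [:: (j, j.+1)] * loop_ab n.+1 [:: (j, k.+1)])%g.
Proof.
move=> hjk; have := @loop_ab_inside n (bcomb n) j k (inord j) (inord k) hjk.
rewrite pair_ab_one mulg1 !inordK; try lia.
by apply=> //; lia.
Qed.

(* The classes of the generators of length 2 on three and on two strands. *)
Local Notation X := (loop_ab 2 [:: (0, 1)]).
Local Notation Y := (loop_ab 1 [:: (0, 1)]).

Lemma loop_ab_gen n j k : j < k <= n -> (j, k) != (0, n) ->
  loop_ab n [:: (j, k)] = (X ^+ (k - j))%g.
Proof.
move=> hjk hne; have hn : k - j < n.
  by move: hne; rewrite xpair_eqE; lia.
have [d ed] : exists d, k = j + d.+1 by exists (k - j).-1; lia.
move: hn hjk; rewrite ed addKn => hn hjk {hne}.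
rewrite loop_ab_span; try lia.
elim: d {k ed n hn hjk} => [|d IH] //.
rewrite expgS -IH (@loop_ab_rec d.+2 0 d.+1 (leqnSn _)).
rewrite (@loop_ab_span _ 0 1) // mulgA loop_ab_sqr // mul1g.
by [].
Qed.

(** The factor Y X is separated so that the exponent of X is the length minus 1,
as in loop_ab_gen. *)
Lemma loop_ab_full n : loop_ab n.+1 [:: (0, n.+1)] = (Y * X * X ^+ n.+1)%g.
Proof.
have X2 : (X * X = 1)%g by rewrite loop_ab_sqr.
have Z : (Y * X * X = Y)%g by rewrite -mulgA X2 mulg1.
elim: n => [|n IH]; first by rewrite expg1 Z.
rewrite expgSr mulgA -IH (@loop_ab_rec n.+1 0 n.+1 (leqnn _)).
by rewrite (@loop_ab_span _ 0 1) // [(X * _)%g]ab_mulC -mulgA X2 mulg1.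
Qed.

(** * Two parities *)

Definition full_count n (w : seq cgen) : nat := count (pred1 (0, n)) w.

(** A generator contributes its length minus 1, which is odd exactly when its
length is even. *)
Definition span_sum (w : seq cgen) : nat := \sum_(g <- w) (g.2 - g.1).

Lemma loop_ab_word n w : all (valid_gen n.+1) w ->
  loop_ab n w = ((Y * X) ^+ full_count n w * X ^+ span_sum w)%g.
Proof.
rewrite /span_sum; elim: w => [|[j k] w IH] hw.
  by rewrite loop_ab_nil big_nil mulg1.
have [hg hw'] : valid_gen n.+1 (j, k) /\ all (valid_gen n.+1) w by apply/andP.
rewrite loop_ab_cons // IH // big_cons /= !expgnDr.
have -> : loop_ab n [:: (j, k)] =
    ((Y * X) ^+ ((j, k) == (0, n)) * X ^+ (k - j))%g.
  have [[e1 e2]|ne] := eqVneq (j, k) (0, n).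
    by case: n e2 hg {IH hw hw'} => [|n] ->; rewrite e1 //= loop_ab_full subn0.
  by rewrite mul1g loop_ab_gen.
rewrite -!mulgA; congr (_ * _)%g; rewrite !mulgA; congr (_ * _)%g.
exact: ab_mulC.
Qed.

Lemma expg_odd (G : groupType) (x : G) m :
  (x * x = 1)%g -> (x ^+ m = x ^+ odd m)%g.
Proof.
move=> h; rewrite -[m in LHS]odd_double_half expgnDr -mul2n expgnA.
by rewrite expg2 h expg1n mulg1.
Qed.

Definition weight n (w : seq cgen) : ('Z_2 * 'Z_2)%type :=
  ((full_count n w)%:R, (span_sum w)%:R)%R.

Lemma natr2_odd m : (m%:R = (odd m)%:R :> 'Z_2)%R.
Proof.
rewrite -[m in LHS]odd_double_half -mul2n GRing.natrD GRing.natrM.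
have -> : (2%:R = 0 :> 'Z_2)%R by exact: val_inj.
by rewrite GRing.mul0r GRing.addr0.
Qed.

Lemma eq_natr2 m p : (m%:R = p%:R :> 'Z_2)%R <-> odd m = odd p.
Proof.
split=> [|e]; last by rewrite natr2_odd e -natr2_odd.
rewrite natr2_odd [RHS]natr2_odd => /(congr1 val) /=.
by case: (odd m); case: (odd p).
Qed.

Lemma weightP n w m v : weight n w = weight m v <->
  odd (full_count n w) = odd (full_count m v) /\
  odd (span_sum w) = odd (span_sum v).
Proof.
split=> [[/eq_natr2 e1 /eq_natr2 e2] //|[e1 e2]].
by congr pair; apply/eq_natr2.
Qed.

Lemma weight_cat n u v : weight n (u ++ v) = (weight n u + weight n v)%R.
Proof.
by rewrite /weight /full_count /span_sum count_cat big_cat /= !GRing.natrD.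
Qed.

Lemma weight1 n g : weight n [:: g] = ((g == (0, n))%:R, (g.2 - g.1)%:R)%R.
Proof. by rewrite /weight /full_count /span_sum big_seq1 /= addn0. Qed.

Lemma weight_cons n g w : weight n (g :: w) = (weight n [:: g] + weight n w)%R.
Proof. exact: (weight_cat n [:: g]). Qed.

Lemma addZ2_self (x : 'Z_2 * 'Z_2) : (x + x = 0)%R.
Proof.
case: x => a b; congr pair.
  by case: a => -[|[|//]] h; exact: val_inj.
by case: b => -[|[|//]] h; exact: val_inj.
Qed.

Lemma weight_rel n x y : cactus_rel n.+1 x y -> weight n x = weight n y.
Proof.
case=> [i j hij|i j k l _ _ _|i j k l h1 h2 h3 h4].
all: rewrite !(weight_cons _ _ [:: _]).
- by rewrite addZ2_self /weight /full_count /span_sum big_nil.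
- exact: GRing.addrC.
(* The two nested generators have the same length, and if one of them flips all
   strands so does the outer one, and then all three are equal. *)
have e : weight n [:: (i + j - l, i + j - k)] = weight n [:: (k, l)].
  rewrite !weight1 /=; congr (_%:R, _%:R)%R; last by lia.
  congr (nat_of_bool _); rewrite !xpair_eqE.
  by apply/andP/andP => -[/eqP e1 /eqP e2]; split; apply/eqP; lia.
by rewrite e GRing.addrC.
Qed.

Lemma weight_eq n u v : cactus_eq n.+1 u v -> weight n u = weight n v.
Proof.
elim=> {u v} [u v x y /weight_rel h|u|u v _ ->|u v w _ -> _ ->] //.
by rewrite !weight_cat h.
Qed.

(** A letter (j, k) containing the cloned strand becomes (p, p+1) and (j, k+1):
the sum of the spans grows by 2, and (j, k+1) flips all strands exactly when
(j, k) does. *)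
Lemma weight_clone n w p : p < n.+1 -> all (valid_gen n.+1) w ->
  weight n.+1 (clone_word p w) = weight n w.
Proof.
elim: w p => [|[j k] w IH] p // hp /= /andP[hg hw].
rewrite weight_cat IH //; last exact: flip_lt.
rewrite [RHS]weight_cons; congr (_ + _)%R.
move: hg; rewrite /valid_gen /= => hg.
have full2 : (p, p.+1) == (0, n.+1) = false by rewrite xpair_eqE; lia.
case: ifP => hkp; last case: ifP => hjp;
  rewrite ?(weight_cons _ _ [:: _]) !weight1 /=.
- have -> : (j, k) == (0, n.+1) = ((j, k) == (0, n)) by
    rewrite !xpair_eqE; lia.
  by [].
- have -> : (j, k.+1) == (0, n.+1) = ((j, k) == (0, n)) by
    rewrite !xpair_eqE eqSS.
  rewrite full2 subSnn subSn; last by lia.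
  congr pair; first by rewrite /= GRing.add0r.
  by rewrite /= -GRing.natrD; apply/eq_natr2 => /=; lia.
- have -> : (j, k) == (0, n) = false by [rewrite xpair_eqE; lia].
  by rewrite subSS.
Qed.

Definition ct_weight (P : ctpair) : ('Z_2 * 'Z_2)%type :=
  weight (ct_size P).-1 (val (repr (ct_elt P))).

Lemma ct_weightE n (S T : btree n.+1) w : all (valid_gen n.+1) w ->
  ct_weight (CTPair S (word_elt n.+1 w) T) = weight n w.
Proof.
move=> hw; rewrite /ct_weight (word_eltE hw); apply: weight_eq (repr_classP hw).
Qed.

Lemma ct_weight_expand P i : ct_weight (@expand P i) = ct_weight P.
Proof.
case: P i => -[|n] S s T i; first by case: i.
move: s i; elim/word_eltP => w hw i.
rewrite /expand /= word_elt_clone // !ct_weightE ?weight_clone //.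
exact: clone_valid.
Qed.

Lemma ct_weight_equiv P Q : ct_equiv P Q -> ct_weight P = ct_weight Q.
Proof.
elim=> {P Q} [P Q [i ->]|P|P Q _ ->|P Q R _ -> _ ->] //.
by rewrite ct_weight_expand.
Qed.

Lemma ct_weight_mul P Q R : ct_mul P Q R ->
  ct_weight R = (ct_weight P + ct_weight Q)%R.
Proof.
case=> -[|n] S T U s t.
  by case: S => -[|a b] //= h; have := leaves_gt0 a; lia.
move: s t; elim/word_eltP => u hu; elim/word_eltP => v hv.
by rewrite -word_elt_cat // !ct_weightE ?weight_cat //; exact: valid_cat.
Qed.

Definition cv_weight (x : CV) : ('Z_2 * 'Z_2)%type := ct_weight (repr x).

Lemma cv_weightE P : cv_weight (cv_class P) = ct_weight P.
Proof. by apply: ct_weight_equiv; apply/cv_classP; exact: reprK. Qed.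

Lemma cv_weightM : {morph cv_weight : x y / (x * y)%g >-> (x + y)%R}.
Proof.
elim/cvW => P; elim/cvW => Q.
have [P' [Q' [R' [hP hQ h]]]] := ct_mul_total P Q.
rewrite -(expands_class hP) -(expands_class hQ) [(_ * _)%g](cv_mulE h).
by rewrite !cv_weightE; exact: ct_weight_mul.
Qed.

Lemma morph_derived (G : groupType) (V : zmodType) (f : G -> V) :
  {morph f : x y / (x * y)%g >-> (x + y)%R} -> forall x, derived x -> f x = 0%R.
Proof.
move=> fM.
have f1 : f 1%g = 0%R.
  by apply: (GRing.addrI (f 1%g)); rewrite -fM mulg1 GRing.addr0.
have fV x : f x^-1%g = (- f x)%R.
  by apply: (GRing.addrI (f x)); rewrite -fM mulgV f1 GRing.subrr.
move=> x; elim=> {x} [x y||x y _ hx _ hy|x _ hx] //.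
- by rewrite !fM !fV [(f x + f y)%R]GRing.addrC GRing.addKr GRing.addNr.
- by rewrite fM hx hy GRing.addr0.
- by rewrite fV hx GRing.oppr0.
Qed.

Definition ab_weight (a : CVab) : ('Z_2 * 'Z_2)%type := cv_weight (repr a).

Lemma ab_weightE x : ab_weight (ab_class x) = cv_weight x.
Proof.
have h := morph_derived cv_weightM (repr_ab x).
rewrite -[x in RHS](mulKVg (repr (ab_class x))) cv_weightM h.
by rewrite GRing.addr0.
Qed.

(** As F dies, a class is a product of powers of the involutions Y X and X, so
only the parities of the exponents matter, and these are what the weight
records. *)
Lemma ab_class_weight x y :
  cv_weight x = cv_weight y -> ab_class x = ab_class y.
Proof.
have X2 : (X * X = 1)%g by rewrite loop_ab_sqr.
have YX2 : ((Y * X) * (Y * X) = 1)%g.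
  rewrite [in X in (_ * X)%g]ab_mulC mulgA -[(Y * X * X)%g]mulgA X2 mulg1.
  by rewrite loop_ab_sqr.
suff key P : exists n w, cv_weight (cv_class P) = weight n w /\
    ab_class (cv_class P) =
      ((Y * X) ^+ odd (full_count n w) * X ^+ odd (span_sum w))%g.
  elim/cvW: x => P; elim/cvW: y => Q.
  have [n [w [-> ->]]] := key P; have [m [v [-> ->]]] := key Q.
  by move=> /weightP[-> ->].
case: P => -[|n] S s T.
  by case: S => -[|a b] //= h; have := leaves_gt0 a; lia.
elim/word_eltP: s => w hw; exists n, w; split.
  by rewrite cv_weightE ct_weightE.
have := pair_abM S S T (word_elt n.+1 w) 1%g.
by rewrite mulg1 pair_ab_one mulg1 loop_abE loop_ab_word //
  (expg_odd _ X2) (expg_odd _ YX2).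
Qed.

Theorem theorem4p10 :
  exists f : abelianization CV -> ('Z_2 * 'Z_2)%type,
    bijective f /\ {morph f : x y / (x * y)%g >-> (x + y)%R}.
Proof.
have wM : {morph ab_weight : x y / (x * y)%g >-> (x + y)%R}.
  by elim/abW => x; elim/abW => y; rewrite -ab_classM !ab_weightE cv_weightM.
exists ab_weight; split=> //.
have inj : injective ab_weight.
  elim/abW => x; elim/abW => y; rewrite !ab_weightE; exact: ab_class_weight.
have wX : ab_weight X = (0, 1)%R.
  by rewrite ab_weightE cv_weightE ct_weightE // /weight /span_sum big_seq1.
have wY : ab_weight Y = (1, 1)%R.
  by rewrite ab_weightE cv_weightE ct_weightE // /weight /span_sum big_seq1.
have surj p : exists a, ab_weight a = p.
  have Z2 (a : 'Z_2) : a = 0%R \/ a = 1%R.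
    by case: a => -[|[|//]] h; [left | right]; exact: val_inj.
  case: p => a b; case: (Z2 a) => ->; case: (Z2 b) => ->.
  - exists 1%g; rewrite [1%g]/(ab_class 1%g) ab_weightE.
    by apply: (morph_derived cv_weightM); exact: Derived1.
  - by exists X.
  - by exists (Y * X)%g; rewrite wM wX wY; congr pair; exact: val_inj.
  - by exists Y.
exists (fun p => sval (cid (surj p))) => [a|p]; last by case: cid.
by apply: inj; case: cid.
Qed.
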